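(* There exist absolute constants $c,C>0$ such that for every finite set $A\subset\mathbb{R}$ with $|A|\ge 2$, $$|A(A-A)| \;\ge\; C\,\frac{|A|^{\frac32+\frac1{34}}}{(\log |A(A-A)|)^{c}}.$$
   Context: All logarithms are base $2$. $A(A-A):=\{a(b-c): a,b,c\in A\}$. The paper writes this conclusion as $|A(A-A)|\gtrapprox |A|^{3/2+1/34}$, where $X\gtrapprox Y$ means that there is an absolute constant $c>0$ such that $X\gg Y/(\log X)^c$, and $X\gg Y$ means $X\ge C Y$ for some absolute constant $C>0$. *)

(* Defs.v *)
From mathcomp Require Import all_boot all_order all_algebra finmap.
From mathcomp Require Import all_classical all_reals all_analysis.

Set Implicit Arguments.
Unset Strict Implicit.
Unset Printing Implicit Defensive.

Import Order.TTheory GRing.Theory Num.Theory.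
Local Open Scope fset_scope.
Local Open Scope ring_scope.

Definition log2 (R : realType) (x : R) : R := ln x / ln 2.

(* The set A(A - A), of all a (b - c) with a, b, c in A; the triple (a, b, c)
   is encoded as (a, (b, c)). *)
Definition prod_diff_set (R : realType) (A : {fset R}) : {fset R} :=
  [fset x.1 * (x.2.1 - x.2.2) | x in A `*` (A `*` A)].

(* Main.v *)
Require Import Defs.
From mathcomp Require Import all_boot all_order all_algebra finmap.
From mathcomp Require Import all_classical all_reals all_analysis.
From mathcomp Require Import zify ring lra.

Set Implicit Arguments.
Unset Strict Implicit.
Unset Printing Implicit Defensive.

Import Order.TTheory GRing.Theory Num.Theory.
Local Open Scope fset_scope.
Local Open Scope ring_scope.

(** Write N for the cardinal of A, S for A(A - A), E for the multiplicative
energy of A, and ignore logarithms. We may remove 0 from A. The bound is a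
trade-off between two inequalities that depend on E in opposite directions:

  N^6 <= S^2 E                   [energy_prod_diff]
  E^6 <= N^10 |A - A|^5          [mult_energy_le_diff]

together with |A - A| <= S, since a(A - A) lies in A(A - A) for any nonzero a
in A. Raising the first to the power 6 and inserting the second gives
N^26 <= S^17, that is S >= N^(26/17), and 26/17 = 3/2 + 1/34.

Both inequalities rest on a Szemeredi-Trotter bound for the points of a
Cartesian product, which has an elementary proof by cutting the grid into
boxes [grid_incidence]: a line of nonzero slope is monotone, hence meets few
boxes, and two distinct points determine at most one line, so few lines have
two points in a common box. Optimising the box size bounds the number of lines
that are v/u-rich on average by a multiple of |A|^2 |B|^2 (u/v)^3 [rich_lines].

First inequality. By Cauchy-Schwarz N^6 is at most S times the number of
solutions of a(b - c) = a'(b' - c'). With m = a/a' the equation says that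
(b, b') and (c, c') lie on a common line of slope m, so the solutions are counted
by the sum over all lines y = m x + k of r(m) i(m, k)^2, where r(m) is the number
of representations of m as a ratio and i the number of grid points on the line.
Cauchy-Schwarz in m separates r, which produces E, from the incidences, which
rich_lines controls on each dyadic range of i.

Second inequality. Choose dyadically a set P of ratios with about d
representations each that carries E, so E is about d^2 |P|, and then a set A'
of elements a for which a P hits A about q times, so q |A'| is about d |P|.
If x = a - b with a in A', then each p in P with p a in A puts the point
(p a, b) of the grid A x B on the line b = u/p - x; by rich_lines few x have many
such representations [few_popular_diffs_ratio]. For a set with few popular
differences, the argument of Shkredov combining the third moment of the
representation function with the inclusion of Katz and Koester forces many
differences [few_popular_diffs_growth]. Keeping the exact dependence on d, q, |P|
and |A'| until the end is what makes the loss only E^6 N^(-10).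

All inequalities are kept between natural numbers, with powers cleared, and every
dyadic decomposition costs one factor l, where N < 2^l. *)

(** * Counting and pigeonhole *)

Lemma sum_nat_CauchySchwarz (T : Type) (s : seq T) (f g : T -> nat) :
  ((\sum_(x <- s) f x * g x) ^ 2
     <= (\sum_(x <- s) f x ^ 2) * \sum_(x <- s) g x ^ 2)%N.
Proof.
elim: s => [|x s IHs]; first by rewrite !big_nil.
rewrite !big_cons.
move: IHs.
set S := (\sum_(y <- s) f y * g y)%N.
set F := (\sum_(y <- s) f y ^ 2)%N.
set G := (\sum_(y <- s) g y ^ 2)%N.
move=> IHs.
have cross : (2 * (S * (f x * g x)) <= F * g x ^ 2 + G * f x ^ 2)%N.
  rewrite -leq_sqr.
  apply: leq_trans (nat_AGM2 _ _).
  have -> : ((2 * (S * (f x * g x))) ^ 2 = 4 * (S ^ 2 * (f x * g x) ^ 2))%N.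
    by ring.
  have -> : (4 * (F * g x ^ 2 * (G * f x ^ 2)) = 4 * (F * G * (f x * g x) ^ 2))%N.
    by ring.
  by rewrite leq_mul2l leq_mul2r IHs orbT.
have -> : ((f x * g x + S) ^ 2 = (f x * g x) ^ 2 + 2 * (S * (f x * g x)) + S ^ 2)%N.
  by ring.
have -> : ((f x ^ 2 + F) * (g x ^ 2 + G)
   = (f x * g x) ^ 2 + (F * g x ^ 2 + G * f x ^ 2) + F * G)%N by ring.
by rewrite leq_add // leq_add2l.
Qed.

Lemma sum_ord_pigeonhole (l : nat) (F : nat -> nat) :
  (0 < l)%N ->
  exists2 j, (j < l)%N & (\sum_(i < l) F i <= l * F j)%N.
Proof.
move=> l_gt0.
have [|j maxj] := @bigop.eq_bigmax _ (fun i : 'I_l => F i); first by rewrite card_ord.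
exists j => //.
rewrite -[X in (_ <= X * _)%N]card_ord -sum_nat_const.
apply: leq_sum => i _.
by rewrite -maxj (bigop.leq_bigmax i).
Qed.

(** A point with f x > 0 lies in exactly one class 2^j <= f x < 2^(j+1) with
j < l, on which f x ^ k is at most 2^((j+1)k); one of the l classes carries at
least a 1/l share of the sum. *)
Lemma dyadic_pigeonhole (T : eqType) (s : seq T) (w f : T -> nat) (k l : nat) :
  (0 < l)%N -> (0 < k)%N -> (forall x, x \in s -> f x < 2 ^ l)%N ->
  exists2 j, (j < l)%N &
    (\sum_(x <- s) w x * f x ^ k
       <= l * (2 ^ (j.+1 * k) * \sum_(x <- s | 2 ^ j <= f x < 2 ^ j.+1) w x))%N.
Proof.
move=> l_gt0 k_gt0 f_lt.
have [j j_lt Hj] := sum_ord_pigeonhole (fun j =>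
  2 ^ (j.+1 * k) * \sum_(x <- s | 2 ^ j <= f x < 2 ^ j.+1) w x)%N l_gt0.
exists j => //; apply: leq_trans Hj.
under [leqRHS]eq_bigr do rewrite big_distrr /= big_mkcond.
rewrite exchange_big /= big_seq [leqRHS]big_seq.
apply: leq_sum => x xs.
have [->|fx_gt0] := posnP (f x); first by rewrite exp0n // muln0.
have /andP[lo hi] := trunc_log_bounds (ltnSn 1) fx_gt0.
have jl : (trunc_log 2 (f x) < l)%N.
  by rewrite -(ltn_exp2l _ _ (ltnSn 1)); apply: leq_ltn_trans lo (f_lt _ xs).
rewrite (bigD1 (Ordinal jl)) //= lo hi /=.
apply: leq_trans (leq_addr _ _).
by rewrite mulnC leq_mul2r expnM leq_exp2r // (ltnW hi) orbT.
Qed.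

Lemma sum_bool_count (T : Type) (s : seq T) (P : pred T) :
  (\sum_(x <- s) P x)%N = count P s.
Proof. by rewrite -sum1_count [RHS]big_mkcond; apply: eq_bigr => x _; case: (P x). Qed.

Lemma sum_inj_leq (T U : eqType) (s : seq T) (t : seq U) (P : pred T)
    (f : T -> U) :
  uniq s -> {in [pred x in s | P x] &, injective f} ->
  (forall x, x \in s -> P x -> f x \in t) ->
  (\sum_(x <- s) P x <= size t)%N.
Proof.
move=> uniq_s f_inj f_t; rewrite sum_bool_count -size_filter -(size_map f).
apply: uniq_leq_size.
  rewrite map_inj_in_uniq ?filter_uniq // => x y.
  by rewrite !mem_filter => /andP[Px xs] /andP[Py ys]; apply: f_inj; rewrite inE ?xs ?ys.
move=> _ /mapP[x + ->]; rewrite mem_filter => /andP[Px xs]; exact: f_t.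
Qed.

Lemma sum_eq_mem (T : choiceType) (A : {fset T}) (y : T) :
  (\sum_(x <- A) (x == y))%N = (y \in A).
Proof. by rewrite sum_bool_count count_uniq_mem ?fset_uniq. Qed.

(** Summing over the values of f with multiplicity is summing over its arguments.
Together with sum_eq_mem this is how every count of solutions of an equation is
rearranged below. *)
Lemma sum_fiber (T : Type) (U : choiceType) (s : seq T) (Y : {fset U})
    (f : T -> U) (F : U -> nat) :
  (\sum_(y <- Y) (\sum_(x <- s) (f x == y)) * F y
     = \sum_(x <- s) (f x \in Y) * F (f x))%N.
Proof.
under eq_bigr do rewrite big_distrl /=.
rewrite exchange_big /=; apply: eq_bigr => x _.
rewrite -sum_eq_mem big_distrl /=; apply: eq_bigr => y _.
by rewrite eq_sym; case: eqP => // ->.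
Qed.

(** Listing s, each element either opens a new class of f or forms a pair with an
earlier element of its class. This bounds a set by the number of classes plus
the number of coincidences, which is how incidences are counted box by box. *)
Lemma size_class_pairs (T U : eqType) (s : seq T) (f : T -> U) (t : seq U) :
  uniq s -> {in s, forall x, f x \in t} ->
  (size s <= size t + \sum_(x <- s) \sum_(y <- s) ((x != y) && (f x == f y)))%N.
Proof.
move=> uniq_s f_t.
suff: (size s <= size (undup (map f s))
         + \sum_(x <- s) \sum_(y <- s) ((x != y) && (f x == f y)))%N.
  move=> /leq_trans; apply; rewrite leq_add2r.
  apply: uniq_leq_size; first exact: undup_uniq.
  by move=> y; rewrite mem_undup => /mapP[x xs ->]; apply: f_t.
elim: s uniq_s {f_t} => [|a s IHs] //= /andP[a_s /IHs{}IHs].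
have mono : (\sum_(x <- s) \sum_(y <- s) ((x != y) && (f x == f y))
   <= \sum_(x <- s) \sum_(y <- a :: s) ((x != y) && (f x == f y)))%N.
  by apply: leq_sum => x _; rewrite big_cons leq_addl.
rewrite !big_cons eqxx /= add0n.
case: ifP => [/mapP[b bs fab]|_] /=; last first.
  rewrite addSn ltnS; apply: leq_trans IHs _; rewrite leq_add2l.
  exact: leq_trans mono (leq_addl _ _).
have pos : (0 < \sum_(y <- s) ((a != y) && (f a == f y)))%N.
  rewrite sum_bool_count -has_count; apply/hasP; exists b => //.
  by rewrite fab eqxx andbT; apply: contraNneq a_s => ->.
rewrite addnCA; apply: leq_trans (leq_add pos _); last first.
  by apply: leq_trans IHs _; rewrite leq_add2l; exact: mono.
by rewrite add1n.
Qed.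

(** * Incidences between lines and grids *)

Definition line_at (R : realFieldType) (l : R * R) (a : R) : R := l.1 * a + l.2.

Definition line_incidence (R : realFieldType) (A B : {fset R}) (l : R * R) : nat :=
  (\sum_(a <- A) (line_at l a \in B))%N.

Definition fset_rank (R : realFieldType) (A : {fset R}) (a : R) : nat :=
  (\sum_(x <- A) (x < a)%R)%N.

Lemma fset_rank_le (R : realFieldType) (A : {fset R}) (a b : R) :
  a <= b -> (fset_rank A a <= fset_rank A b)%N.
Proof.
move=> ab; apply: leq_sum => x _.
by case: (ltP x a) => // xa; rewrite (lt_le_trans xa ab).
Qed.

Lemma fset_rank_lt (R : realFieldType) (A : {fset R}) (a b : R) :
  a \in A -> a < b -> (fset_rank A a < fset_rank A b)%N.
Proof.
move=> aA ab; rewrite /fset_rank !(big_fsetD1 _ aA) /= ltxx ab add0n add1n ltnS.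
exact: fset_rank_le (ltW ab).
Qed.

Lemma fset_rank_lt_card (R : realFieldType) (A : {fset R}) (a : R) :
  a \in A -> (fset_rank A a < #|` A|)%N.
Proof.
move=> aA; rewrite /fset_rank card_fset_sum1 !(big_fsetD1 _ aA) /= ltxx add0n add1n ltnS.
by apply: leq_sum => x _; case: (x < a).
Qed.

Lemma fset_rank_inj (R : realFieldType) (A : {fset R}) : {in A &, injective (fset_rank A)}.
Proof.
move=> a b aA bA ab; case: (ltgtP a b) => // [/(fset_rank_lt aA)|/(fset_rank_lt bA)];
  by rewrite ab ltnn.
Qed.

(** Blocks of s consecutive elements of A; the product of the blocks of A and of B
cuts the grid into boxes. *)
Definition cell (R : realFieldType) (A : {fset R}) (s : nat) (a : R) : nat :=
  (fset_rank A a %/ s)%N.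

Lemma cell_le (R : realFieldType) (A : {fset R}) (s : nat) (a b : R) :
  a <= b -> (cell A s a <= cell A s b)%N.
Proof. by move=> ab; apply: leq_div2r; apply: fset_rank_le. Qed.

Lemma cell_bound (R : realFieldType) (A : {fset R}) (s : nat) (a : R) :
  a \in A -> (cell A s a <= #|` A| %/ s)%N.
Proof. by move=> aA; apply: leq_div2r; apply/ltnW/fset_rank_lt_card. Qed.

Lemma cell_card (R : realFieldType) (A : {fset R}) (s c : nat) :
  (0 < s)%N -> (\sum_(a <- A) (cell A s a == c) <= s)%N.
Proof.
move=> s_gt0; rewrite -[leqRHS](size_iota (c * s)).
apply: (sum_inj_leq (f := fset_rank A)) => [|a b|a aA /eqP <-]; first exact: fset_uniq.
  by rewrite !inE => /andP[aA _] /andP[bA _]; apply: fset_rank_inj.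
rewrite mem_iota leq_divM /=.
by rewrite addnC -mulSn ltn_ceil.
Qed.

Lemma same_cell_pairs (R : realFieldType) (A : {fset R}) (s : nat) :
  (0 < s)%N ->
  (\sum_(a <- A) \sum_(b <- A) (cell A s a == cell A s b) <= #|` A| * s)%N.
Proof.
move=> s_gt0; rewrite card_fset_sum1 big_distrl /=; apply: leq_sum => a _.
by rewrite mul1n; under eq_bigr do rewrite eq_sym; apply: cell_card.
Qed.

(** A line of positive slope meets boxes whose two indices increase together, so
the sum of the indices separates the boxes that it meets; for a negative slope
the second index is reversed first. Hence the line meets at most
|A|/s + |B|/s' + 1 boxes, and further points pair up inside boxes. *)
Lemma line_incidence_cells (R : realFieldType) (A B : {fset R}) (s s' : nat)
    (l : R * R) :
  l.1 != 0 ->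
  (line_incidence A B l <= (#|` A| %/ s + #|` B| %/ s').+1
     + \sum_(a <- A) \sum_(a' <- A | a != a')
         [&& line_at l a \in B, line_at l a' \in B, cell A s a == cell A s a'
           & cell B s' (line_at l a) == cell B s' (line_at l a')])%N.
Proof.
case: l => m k /= m0.
pose y := line_at (m, k).
set J := (#|` B| %/ s')%N.
(* the index sum, with the second index reversed for negative slope *)
pose cls a := (cell A s a + if (0 < m)%R then cell B s' (y a) else J - cell B s' (y a))%N.
pose Q := [seq a <- A | y a \in B].
have clsP a a' : y a \in B -> y a' \in B -> cls a = cls a' ->
    cell A s a = cell A s a' /\ cell B s' (y a) = cell B s' (y a').
  have step b b' : b <= b' -> y b \in B -> y b' \in B -> cls b = cls b' ->
    cell A s b = cell A s b' /\ cell B s' (y b) = cell B s' (y b').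
    move=> bb' /(cell_bound s') + /(cell_bound s'); rewrite -/J /cls.
    have := cell_le A s bb'.
    case: ltP => [m_gt0|m_le0].
      have /(cell_le B s') : y b <= y b' by rewrite /y /line_at lerD2r ler_pM2l.
      by lia.
    have /(cell_le B s') : y b' <= y b by rewrite /y /line_at lerD2r ler_nM2l // lt_neqAle m0.
    by lia.
  move=> yaB ya'B caa'; case: (leP a a') => [aa'|/ltW a'a]; first exact: step.
  by have [] := step _ _ a'a ya'B yaB (esym caa').
have -> : line_incidence A B (m, k) = size Q.
  by rewrite /line_incidence sum_bool_count size_filter.
have cls_iota : {in Q, forall a, cls a \in iota 0 (#|` A| %/ s + J).+1}.
  move=> a; rewrite mem_filter => /andP[yaB /(cell_bound s) aA].
  rewrite mem_iota /= add0n ltnS /cls leq_add //.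
  by case: ifP => _; rewrite ?leq_subr // cell_bound.
have := size_class_pairs (filter_uniq _ (fset_uniq A)) cls_iota.
rewrite size_iota => /leq_trans; apply; rewrite leq_add2l.
rewrite !big_filter big_mkcond /=; apply: leq_sum => a _.
case: ifP => // yaB; rewrite big_filter big_mkcond [leqRHS]big_mkcond /=.
apply: leq_sum => a' _; case: ifP => // ya'B.
case: eqP => //= _; case: eqP => // /(clsP _ _ yaB ya'B)[-> ->].
by rewrite !eqxx.
Qed.

Lemma two_points_line (R : realFieldType) (a a' : R) (l l' : R * R) :
  a != a' -> line_at l a = line_at l' a -> line_at l a' = line_at l' a' -> l = l'.
Proof.
case: l l' => [m k] [m' k']; rewrite /line_at /= => aa' e e'.
have /eqP : (m - m') * (a - a') = 0.
  have -> : (m - m') * (a - a')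
      = (m * a + k) - (m' * a + k') - ((m * a' + k) - (m' * a' + k')) by ring.
  by rewrite e e' !subrr.
rewrite mulf_eq0 !subr_eq0 (negPf aa') orbF => /eqP mm'.
by move: e; rewrite mm' => /addrI ->.
Qed.

(** The pairs of points in a common box number at most |A| s |B| s', and a pair
with distinct abscissae is counted for at most one line. *)
Lemma grid_incidence (R : realFieldType) (A B : {fset R}) (L : {fset R * R})
    (s s' : nat) :
  {in L, forall l, l.1 != 0} -> (0 < s)%N -> (0 < s')%N ->
  (\sum_(l <- L) line_incidence A B l
     <= (#|` A| %/ s + #|` B| %/ s').+1 * #|` L|
        + (#|` A| * s) * (#|` B| * s'))%N.
Proof.
move=> L0 s_gt0 s'_gt0.
set K := (_ + _).+1.
pose hit l a a' := [&& line_at l a \in B, line_at l a' \in B, cell A s a == cell A s a'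
           & cell B s' (line_at l a) == cell B s' (line_at l a')].
have line_le : (\sum_(l <- L) line_incidence A B l
   <= \sum_(l <- L) (K + \sum_(a <- A) \sum_(a' <- A | a != a') hit l a a'))%N.
  rewrite big_seq [leqRHS]big_seq; apply: leq_sum => l /L0 l0.
  exact: line_incidence_cells.
apply: leq_trans line_le _.
rewrite big_split /= big_const_seq count_predT iter_addn addn0 leq_add2l.
rewrite exchange_big /=.
apply: leq_trans (leq_mul (same_cell_pairs A s_gt0) (leqnn _)).
rewrite big_distrl /=; apply: leq_sum => a _.
rewrite exchange_big /= big_distrl /= big_mkcond; apply: leq_sum => a' _ /=.
case: ifP => // aa'.
have [caa'|caa'] := boolP (cell A s a == cell A s a'); last first.
  by rewrite big1 // => l _; rewrite /hit (negPf caa') !andbF.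
rewrite mul1n; apply: leq_trans (same_cell_pairs B s'_gt0).
pose T := [seq p <- [seq (b, b') | b <- B, b' <- B] | cell B s' p.1 == cell B s' p.2].
have -> : (\sum_(b <- B) \sum_(b' <- B) (cell B s' b == cell B s' b') = size T)%N.
  rewrite size_filter -sum_bool_count big_allpairs_dep /=.
  by [].
apply: (sum_inj_leq (f := fun l => (line_at l a, line_at l a'))).
- exact: fset_uniq.
- by move=> l l' _ _ [] e e'; apply: two_points_line e e'.
- move=> l _ /and4P[h1 h2 _ h4].
  by rewrite mem_filter h4 /=; apply/allpairsP; exists (line_at l a, line_at l a').
Qed.

Lemma line_incidence_le_left (R : realFieldType) (A B : {fset R}) (l : R * R) :
  (line_incidence A B l <= #|` A|)%N.
Proof. by rewrite card_fset_sum1; apply: leq_sum => a _; case: (_ \in _). Qed.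

Lemma line_at_inj (R : realFieldType) (l : R * R) : l.1 != 0 -> injective (line_at l).
Proof. by move=> l0 a b /addIr/(mulfI l0). Qed.

Lemma line_incidence_le_right (R : realFieldType) (A B : {fset R}) (l : R * R) :
  l.1 != 0 -> (line_incidence A B l <= #|` B|)%N.
Proof.
move=> l0; apply: (sum_inj_leq (f := line_at l)) => // [|a b _ _].
  exact: fset_uniq.
exact: line_at_inj.
Qed.

(** The incidence bound with block lengths about 4 |A| u / v and 4 |B| u / v: then
a line meets at most v / (2u) + 1 boxes, which is at most 5/8 of the average
v / u of points per line because 8 u <= v, so at least 3/8 of the incidences come
from pairs inside boxes. The richness is a ratio of naturals since in the
application to ratios it is not an integer. *)
Lemma rich_lines (R : realFieldType) (A B : {fset R}) (L : {fset R * R})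
    (u v : nat) :
  {in L, forall l, l.1 != 0} -> (8 * u <= v)%N ->
  (v * #|` L| <= u * \sum_(l <- L) line_incidence A B l)%N ->
  (v ^ 3 * #|` L| <= 2 ^ 8 * (u ^ 3 * (#|` A| ^ 2 * #|` B| ^ 2)))%N.
Proof.
move=> L0 uv rich.
have [->|L_gt0] := posnP #|` L|; first by rewrite muln0.
have [->|v_gt0] := posnP v; first by rewrite exp0n // mul0n.
(* no line has more than min(|A|, |B|) points, hence neither has the average *)
have mean_le n : {in L, forall l, line_incidence A B l <= n}%N -> (v <= n * u)%N.
  move=> inc_n; rewrite -(leq_pmul2r L_gt0); apply: leq_trans rich _.
  rewrite (mulnC n) -mulnA leq_mul2l; apply/orP; right.
  rewrite card_fset_sum1 big_distrr /= big_seq [leqRHS]big_seq.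
  by apply: leq_sum => l /inc_n; rewrite muln1.
have vA : (v <= #|` A| * u)%N by apply: mean_le => l _; exact: line_incidence_le_left.
have vB : (v <= #|` B| * u)%N.
  by apply: mean_le => l /L0; exact: line_incidence_le_right.
pose width n := (4 * n * u %/ v).+1.
have widthP n : (v <= n * u -> 4 * u * (n %/ width n) <= v /\ width n * v <= 8 * n * u)%N.
  move=> vn.
  have lo : (4 * n * u < width n * v)%N by exact: ltn_ceil.
  have hi : (width n * v <= 4 * n * u + v)%N.
    by rewrite /width mulSn [leqRHS]addnC leq_add2l leq_divM.
  split; last by lia.
  rewrite -(leq_pmul2r (ltn0Sn _ : 0 < width n)%N) [leqRHS]mulnC.
  apply: leq_trans (ltnW lo).
  have -> : (4 * n * u = 4 * u * n)%N by ring.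
  by rewrite -mulnA leq_mul2l leq_divM orbT.
have [dA sA] := widthP _ vA; have [dB sB] := widthP _ vB.
have := grid_incidence A B L0 (ltn0Sn _ : 0 < width #|` A|)%N
  (ltn0Sn _ : 0 < width #|` B|)%N.
move: rich dA sA dB sB; move: (width #|` A|) (width #|` B|) => s s'.
move: (\sum_(_ <- _) _)%N (_ %/ s)%N (_ %/ s')%N => I dA dB rich HdA sA HdB sB HI.
have few : (v * #|` L| <= 4 * u * ((#|` A| * s) * (#|` B| * s')))%N.
  have : (4 * (u * I) <= 4 * u * ((dA + dB).+1 * #|` L| + (#|` A| * s) * (#|` B| * s')))%N.
    by rewrite mulnA leq_mul2l HI orbT.
  have : (4 * u * ((dA + dB).+1 * #|` L|) <= 3 * v * #|` L|)%N.
    by rewrite mulnA leq_mul2r; apply/orP; right; lia.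
  by move: rich; rewrite mulnDr -(mulnA 3); lia.
have -> : (v ^ 3 * #|` L| = v ^ 2 * (v * #|` L|))%N by ring.
apply: leq_trans (_ : v ^ 2 * (4 * u * (#|` A| * s * (#|` B| * s'))) <= _)%N.
  by rewrite leq_mul2l few orbT.
have -> : (v ^ 2 * (4 * u * (#|` A| * s * (#|` B| * s')))
   = 4 * (u * (#|` A| * #|` B|)) * ((s * v) * (s' * v)))%N by ring.
have -> : (2 ^ 8 * (u ^ 3 * (#|` A| ^ 2 * #|` B| ^ 2))
   = 4 * (u * (#|` A| * #|` B|)) * ((8 * #|` A| * u) * (8 * #|` B| * u)))%N.
  by ring.
by rewrite leq_mul2l leq_mul ?orbT.
Qed.

(** * Multiplicative energy against products of differences *)

Lemma sum_fsetM (T U : choiceType) (A : {fset T}) (B : {fset U}) (F : T * U -> nat) :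
  (\sum_(p <- A `*` B) F p = \sum_(a <- A) \sum_(b <- B) F (a, b))%N.
Proof.
transitivity (\sum_(p <- [seq (a, b) | a <- A, b <- B]) F p)%N; last first.
  by rewrite big_allpairs_dep.
apply/perm_big/uniq_perm; first exact: fset_uniq.
  by apply: allpairs_uniq => [||[? ?] [? ?]]; rewrite ?fset_uniq.
move=> [a b]; rewrite in_fsetM /=; apply/andP/allpairsP => [[aA bB]|].
  by exists (a, b).
by case=> -[a' b'] /= [aA bB [-> ->]].
Qed.

Lemma card_fsetM (T U : choiceType) (A : {fset T}) (B : {fset U}) :
  #|` A `*` B| = (#|` A| * #|` B|)%N.
Proof.
rewrite card_fset_sum1 sum_fsetM [in RHS]card_fset_sum1 big_distrl /=.
by apply: eq_bigr => a _; rewrite -card_fset_sum1 mul1n.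
Qed.

Definition rep_ratio (R : realFieldType) (A : {fset R}) (x : R) : nat :=
  (\sum_(a <- A) ((x * a)%R \in A))%N.

Definition ratio_set (R : realFieldType) (A : {fset R}) : {fset R} :=
  [fset x.1 / x.2 | x in A `*` A].

Definition mult_energy (R : realFieldType) (A : {fset R}) : nat :=
  (\sum_(x <- ratio_set A) rep_ratio A x ^ 2)%N.

Lemma mem_ratio_set (R : realFieldType) (A : {fset R}) (a b : R) :
  a \in A -> b \in A -> a / b \in ratio_set A.
Proof. by move=> aA bA; apply/imfsetP; exists (a, b); rewrite //= in_fsetM aA. Qed.

Lemma ratio_set_neq0 (R : realFieldType) (A : {fset R}) :
  0 \notin A -> {in ratio_set A, forall x, x != 0}.
Proof.
move=> A0 _ /imfsetP[[a b] /= + ->]; rewrite in_fsetM => /andP[/= aA bA].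
by rewrite mulf_neq0 // ?invr_eq0; [apply: contraNneq A0 => <-|apply: contraNneq A0 => <-].
Qed.

Lemma card_ratio_set (R : realFieldType) (A : {fset R}) :
  (#|` ratio_set A| <= #|` A| ^ 2)%N.
Proof.
apply: leq_trans (leq_imfset_card _ _ _) _.
by rewrite /= card_fsetM.
Qed.

(** Since 0 is not in A, the pairs (b, a) with m b = a are those with a / b = m. *)
Lemma sum_rep_ratio (R : realFieldType) (A : {fset R}) (F : R -> nat) :
  0 \notin A ->
  (\sum_(x <- ratio_set A) rep_ratio A x * F x
     = \sum_(b <- A) \sum_(a <- A) F (a / b))%N.
Proof.
move=> A0.
transitivity (\sum_(x <- ratio_set A)
   (\sum_(p <- A `*` A) (p.2 / p.1 == x)) * F x)%N.
  apply: eq_bigr => x _; congr (_ * _)%N; rewrite sum_fsetM.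
  rewrite /rep_ratio big_seq [RHS]big_seq; apply: eq_bigr => b bA.
  rewrite -sum_eq_mem; apply: eq_bigr => a _ /=.
  have b0 : b != 0 by apply: contraNneq A0 => <-.
  by congr nat_of_bool; apply/eqP/eqP => [->|<-]; rewrite ?mulfK ?divfK.
rewrite sum_fiber sum_fsetM big_seq [RHS]big_seq; apply: eq_bigr => b bA.
rewrite big_seq [RHS]big_seq; apply: eq_bigr => a aA /=.
by rewrite mem_ratio_set // mul1n.
Qed.

(** The intercepts of all the lines through a point of A x A with slope in A / A. *)
Definition intercept_set (R : realFieldType) (A : {fset R}) : {fset R} :=
  [fset x.2.2 - x.1 * x.2.1 | x in ratio_set A `*` (A `*` A)].

Lemma mem_intercept_set (R : realFieldType) (A : {fset R}) (m a b : R) :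
  m \in ratio_set A -> a \in A -> b \in A -> b - m * a \in intercept_set A.
Proof.
move=> mA aA bA; apply/imfsetP; exists (m, (a, b)) => //=.
by rewrite !in_fsetM /= mA aA.
Qed.

Lemma sum_sqr_line_incidence (R : realFieldType) (A : {fset R}) (m : R) :
  m \in ratio_set A ->
  (\sum_(k <- intercept_set A) line_incidence A A (m, k) ^ 2
     = \sum_(b <- A) \sum_(b' <- A) \sum_(c <- A) \sum_(c' <- A)
         (m * c + (b' - m * b) == c')%R)%N.
Proof.
move=> mA.
transitivity (\sum_(k <- intercept_set A)
   (\sum_(p <- A `*` A) (p.2 - m * p.1 == k)%R) * line_incidence A A (m, k))%N.
  apply: eq_bigr => k _; rewrite -mulnn; congr (_ * _)%N.
  rewrite sum_fsetM; apply: eq_bigr => b _.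
  rewrite -sum_eq_mem; apply: eq_bigr => b' _ /=.
  by rewrite /line_at /= subr_eq addrC.
rewrite sum_fiber sum_fsetM big_seq [RHS]big_seq; apply: eq_bigr => b bA.
rewrite big_seq [RHS]big_seq; apply: eq_bigr => b' b'A /=.
rewrite mem_intercept_set // mul1n; apply: eq_bigr => c _.
by rewrite -sum_eq_mem; apply: eq_bigr => c' _; rewrite eq_sym.
Qed.

(** With m = a / a', the equation a' (b' - c') = a (b - c) reads
m c + (b' - m b) = c': the points (b, b') and (c, c') of A x A lie on a common
line of slope m. *)
Lemma prod_diff_quadruples (R : realFieldType) (A S : {fset R}) :
  0 \notin A ->
  (\sum_(s <- S) (\sum_(t <- A `*` (A `*` A)) (t.1 * (t.2.1 - t.2.2) == s)%R) ^ 2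
     <= \sum_(m <- ratio_set A) rep_ratio A m *
          \sum_(k <- intercept_set A) line_incidence A A (m, k) ^ 2)%N.
Proof.
move=> A0.
pose T := A `*` (A `*` A); pose val (t : R * (R * R)) := t.1 * (t.2.1 - t.2.2).
apply: (@leq_trans (\sum_(t <- T) \sum_(t' <- T) (val t' == val t))).
  under eq_bigr do rewrite -mulnn.
  rewrite (sum_fiber T S val (fun s => \sum_(t <- T) (val t == s))%N).
  by apply: leq_sum => t _; case: (_ \in S); rewrite ?mul0n ?mul1n.
pose G m := (\sum_(k <- intercept_set A) line_incidence A A (m, k) ^ 2)%N.
rewrite (sum_rep_ratio G A0) /T.
rewrite [leqRHS]exchange_big sum_fsetM /=.
rewrite big_seq [leqRHS]big_seq; apply: leq_sum => a aA; rewrite sum_fsetM /=.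
have GE : (\sum_(a' <- A) G (a / a') = \sum_(a' <- A) \sum_(b <- A)
   \sum_(b' <- A) \sum_(c <- A) \sum_(c' <- A)
     (a' * (b' - c') == a * (b - c))%R)%N.
  rewrite big_seq [RHS]big_seq; apply: eq_bigr => a' a'A.
  have a'0 : a' != 0 by apply: contraNneq A0 => <-.
  rewrite /G sum_sqr_line_incidence ?mem_ratio_set //.
  do 4!(apply: eq_bigr => ? _); congr nat_of_bool.
  rewrite -(inj_eq (mulfI a'0)) -subr_eq0 -[RHS]subr_eq0; congr (_ == 0).
  by field.
rewrite GE [leqRHS]exchange_big; apply: leq_sum => b _.
under [leqRHS]eq_bigr do rewrite exchange_big.
rewrite [leqRHS]exchange_big /=; apply: leq_sum => c _.
by rewrite sum_fsetM; apply: leq_sum => a' _; rewrite sum_fsetM.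
Qed.

Lemma sum_line_incidence_le (R : realFieldType) (A K : {fset R}) (m : R) :
  (\sum_(k <- K) line_incidence A A (m, k) <= #|` A| ^ 2)%N.
Proof.
rewrite exchange_big /= [in leqRHS]card_fset_sum1 -mulnn [leqRHS]big_distrl /=.
apply: leq_sum => a _; rewrite -card_fset_sum1 mul1n.
apply: (sum_inj_leq (f := fun k => line_at (m, k) a)) => //; first exact: fset_uniq.
by move=> k k' _ _; apply: addrI.
Qed.

Definition rich_count (R : realFieldType) (A K : {fset R}) (j : nat) (m : R) : nat :=
  (\sum_(k <- K | 2 ^ j <= line_incidence A A (m, k) < 2 ^ j.+1) 1)%N.

(** The lines of a fixed slope partition the N^2 points of the grid. *)
Lemma rich_count_le (R : realFieldType) (A K : {fset R}) (j : nat) (m : R) :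
  (2 ^ j * rich_count A K j m <= #|` A| ^ 2)%N.
Proof.
apply: leq_trans (sum_line_incidence_le A K m).
rewrite /rich_count big_mkcond big_distrr /=; apply: leq_sum => k _.
by case: ifP => [/andP[lo _]|_]; rewrite ?muln1 ?muln0.
Qed.

(** For 2^j >= 8 this is rich_lines with u = 1; for smaller j it suffices that
there are at most N^2 slopes and, by rich_count_le, at most N^2 lines for each. *)
Lemma rich_lines_ratio (R : realFieldType) (A K : {fset R}) (j : nat) :
  0 \notin A ->
  (8 ^ j * \sum_(m <- ratio_set A)
 rich_count A K j m <= 2 ^ 8 * #|` A| ^ 4)%N.
Proof.
move=> A0.
have [j_lt3|j_ge3] := ltnP j 3.
  have nN : (\sum_(m <- ratio_set A) rich_count A K j m <= #|` A| ^ 4)%N.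
    rewrite (_ : 4%N = (2 + 2)%N) // expnD.
    apply: leq_trans (leq_mul (card_ratio_set A) (leqnn _)).
    rewrite card_fset_sum1 big_distrl; apply: leq_sum => m _ /=; rewrite mul1n.
    by apply: leq_trans (rich_count_le A K j m); rewrite leq_pmull // expn_gt0.
  apply: leq_mul nN; rewrite (_ : 8%N = (2 ^ 3)%N) // -expnM leq_exp2l //; lia.
pose L := [fset l in ratio_set A `*` K |
  (2 ^ j <= line_incidence A A l < 2 ^ j.+1)%N].
have cardL : #|` L| = (\sum_(m <- ratio_set A) rich_count A K j m)%N.
  rewrite card_fset_sum1 big_fset /= big_mkcond sum_fsetM /=.
  by apply: eq_bigr => m _; rewrite /rich_count [RHS]big_mkcond.
have L0 : {in L, forall l, l.1 != 0}.
  move=> l; rewrite !inE => /andP[/andP[+ _] _].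
  exact: ratio_set_neq0.
have := @rich_lines _ A A L 1 (2 ^ j) L0.
rewrite cardL muln1 mul1n exp1n mul1n -expnD -expnM (mulnC j) expnM; apply.
  by rewrite (_ : 8%N = (2 ^ 3)%N) // leq_exp2l.
rewrite -cardL card_fset_sum1 big_distrr /= big_seq [leqRHS]big_seq.
by apply: leq_sum => l; rewrite !inE muln1 => /andP[_ /andP[]].
Qed.

(** The number Q of solutions of a(b - c) = a'(b' - c') is carried, up to a factor
l, by lines with about 2^j points. If n(m) is the number of such lines of slope m,
then Q is about 4^j times the sum of r(m) n(m), which Cauchy-Schwarz bounds by the
square root of E times the sum of n(m)^2. The latter is at most
(N^2 / 2^j) (N^4 / 8^j), so the powers of 2^j cancel and Q^2 is at most E N^6. *)
Lemma energy_prod_diff (R : realFieldType) (A S : {fset R}) (l : nat) :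
  0 \notin A -> (0 < l)%N -> (#|` A| < 2 ^ l)%N ->
  (forall a b c, a \in A -> b \in A -> c \in A -> a * (b - c) \in S) ->
  (#|` A| ^ 6 <= 2 ^ 12 * l ^ 2 * #|` S| ^ 2 * mult_energy A)%N.
Proof.
move=> A0 l_gt0 A_lt AS.
have [->|A_gt0] := posnP #|` A|; first by rewrite exp0n.
pose T := A `*` (A `*` A); pose val (t : R * (R * R)) := t.1 * (t.2.1 - t.2.2).
have sumS : (\sum_(s <- S) \sum_(t <- T) (val t == s) = #|` A| ^ 3)%N.
  rewrite exchange_big /= -[RHS]/(#|` A| * (#|` A| * #|` A|))%N -!card_fsetM.
  rewrite card_fset_sum1 -/T big_seq [RHS]big_seq; apply: eq_bigr => -[a [b c]].
  rewrite !in_fsetM => /and3P[/= aA bA cA].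
  by under eq_bigr do rewrite eq_sym; rewrite sum_eq_mem AS.
set Q := (\sum_(m <- ratio_set A) rep_ratio A m *
          \sum_(k <- intercept_set A) line_incidence A A (m, k) ^ 2)%N.
have cauchyS : (#|` A| ^ 6 <= #|` S| * Q)%N.
  have := sum_nat_CauchySchwarz S (fun=> 1%N) (fun s => \sum_(t <- T) (val t == s))%N.
  under eq_bigr do rewrite mul1n.
  rewrite sumS -expnM -card_fset_sum1 => /leq_trans; apply.
  by rewrite leq_mul2l prod_diff_quadruples ?orbT.
have [j j_lt] := @dyadic_pigeonhole _ (ratio_set A `*` intercept_set A)
  (fun x => rep_ratio A x.1) (line_incidence A A) 2 l l_gt0 isT
  (fun x _ => leq_ltn_trans (line_incidence_le_left A A x) A_lt).
rewrite [in X in (_ <= X)%N]big_mkcond !sum_fsetM /=.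
pose n := rich_count A (intercept_set A) j.
have -> : (\sum_(m <- ratio_set A) \sum_(k <- intercept_set A)
   rep_ratio A m * line_incidence A A (m, k) ^ 2 = Q)%N.
  by apply: eq_bigr => m _; rewrite big_distrr.
under [X in (_ <= _ * (_ * X))%N]eq_bigr => m _.
  rewrite (_ : (\sum_(_ <- _) _)%N = (rep_ratio A m * n m)%N); last first.
    rewrite /n /rich_count [in RHS]big_mkcond big_distrr; apply: eq_bigr => k _ /=.
    by case: ifP; rewrite ?muln1 ?muln0.
  over.
move=> Q_le.
have n_sum := rich_lines_ratio (intercept_set A) j A0.
have n_sqr : (16 ^ j * \sum_(m <- ratio_set A) n m ^ 2 <= 2 ^ 8 * #|` A| ^ 6)%N.
  apply: (@leq_trans (#|` A| ^ 2 * (2 ^ 8 * #|` A| ^ 4))); last first.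
    by rewrite mulnCA -expnD.
  apply: leq_trans (leq_mul (leqnn _) n_sum).
  rewrite big_distrr big_distrr big_distrr /=; apply: leq_sum => m _.
  have -> : (16 ^ j = 2 ^ j * 8 ^ j)%N by rewrite -expnMn.
  rewrite (_ : 2 ^ j * 8 ^ j * n m ^ 2 = (2 ^ j * n m) * (8 ^ j * n m))%N.
    by rewrite leq_mul2r rich_count_le orbT.
  by ring.
have := sum_nat_CauchySchwarz (ratio_set A) (rep_ratio A) n.
rewrite -/(mult_energy A).
move: (\sum_(m <- _) n m ^ 2)%N n_sqr (\sum_(m <- _) _)%N Q_le => N2 n_sqr W Q_le W_le.
have Q_sqr : (Q ^ 2 <= 2 ^ 12 * l ^ 2 * mult_energy A * #|` A| ^ 6)%N.
  apply: (@leq_trans ((l * (2 ^ (j.+1 * 2) * W)) ^ 2)); first by rewrite leq_sqr.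
  have -> : ((l * (2 ^ (j.+1 * 2) * W)) ^ 2 = 16 * l ^ 2 * (16 ^ j * W ^ 2))%N.
    have -> : (2 ^ (j.+1 * 2) = 4 * 4 ^ j)%N by rewrite mulnC expnM expnS.
    by have -> : (16 ^ j = (4 ^ j) ^ 2)%N; [rewrite -expnM mulnC expnM | ring].
  apply: (@leq_trans (16 * l ^ 2 * (mult_energy A * (2 ^ 8 * #|` A| ^ 6)))).
    rewrite leq_mul2l; apply/orP; right.
    apply: leq_trans (leq_mul (leqnn _) n_sqr).
    by rewrite mulnCA leq_mul2l W_le orbT.
  by apply/eq_leq; ring.
rewrite -(leq_pmul2r (_ : 0 < #|` A| ^ 6)%N) ?expn_gt0 ?A_gt0 //.
rewrite mulnn; apply: (@leq_trans ((#|` S| * Q) ^ 2)); first by rewrite leq_sqr.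
rewrite expnMn; apply: leq_trans (leq_mul (leqnn _) Q_sqr) _.
by apply/eq_leq; ring.
Qed.

(** * Differences of sets with few popular differences *)

Definition rep_diff (R : realFieldType) (A B : {fset R}) (x : R) : nat :=
  (\sum_(a <- A) ((a - x)%R \in B))%N.

Definition diff_set (R : realFieldType) (A B : {fset R}) : {fset R} :=
  [fset x.1 - x.2 | x in A `*` B].

Lemma mem_diff_set (R : realFieldType) (A B : {fset R}) (a b : R) :
  a \in A -> b \in B -> a - b \in diff_set A B.
Proof. by move=> aA bB; apply/imfsetP; exists (a, b); rewrite //= in_fsetM aA. Qed.

Lemma sum_rep_diff (R : realFieldType) (A B : {fset R}) (F : R -> nat) :
  (\sum_(x <- diff_set A B) rep_diff A B x * F x
     = \sum_(a <- A) \sum_(b <- B) F (a - b)%R)%N.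
Proof.
transitivity (\sum_(x <- diff_set A B)
   (\sum_(p <- A `*` B) (p.1 - p.2 == x)%R) * F x)%N.
  apply: eq_bigr => x _; congr (_ * _)%N; rewrite sum_fsetM.
  apply: eq_bigr => a _; rewrite -sum_eq_mem; apply: eq_bigr => b _ /=.
  by congr nat_of_bool; apply/eqP/eqP => [->|<-]; ring.
rewrite sum_fiber sum_fsetM big_seq [RHS]big_seq; apply: eq_bigr => a aA.
rewrite big_seq [RHS]big_seq; apply: eq_bigr => b bB /=.
by rewrite mem_diff_set // mul1n.
Qed.

Lemma sum_rep_diff_card (R : realFieldType) (A B : {fset R}) :
  (\sum_(x <- diff_set A B) rep_diff A B x = #|` A| * #|` B|)%N.
Proof.
transitivity (\sum_(x <- diff_set A B) rep_diff A B x * 1)%N.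
  by apply: eq_bigr => x _; rewrite muln1.
rewrite (sum_rep_diff A B (fun=> 1%N)) card_fset_sum1 big_distrl /=.
by apply: eq_bigr => a _; rewrite -card_fset_sum1 mul1n.
Qed.

Lemma sum_rep_diff_le (R : realFieldType) (A B X : {fset R}) :
  (\sum_(x <- X) rep_diff A B x <= #|` A| * #|` B|)%N.
Proof.
rewrite exchange_big [in leqRHS]card_fset_sum1 big_distrl /=.
apply: leq_sum => a _; rewrite mul1n.
apply: (sum_inj_leq (f := fun x => a - x)) => //; first exact: fset_uniq.
by move=> x y _ _ /addrI/oppr_inj.
Qed.

Lemma rep_diff_le (R : realFieldType) (A B : {fset R}) (x : R) :
  (rep_diff A B x <= #|` A|)%N.
Proof. by rewrite card_fset_sum1; apply: leq_sum => a _; case: (_ \in _). Qed.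

(** At most (H / q) |B|^2 / t^3 differences have t representations in A - B. The
constant is a ratio because the one that comes from a set of popular ratios is
not an integer. *)
Definition few_popular_diffs (R : realFieldType) (A : {fset R}) (q H : nat) :=
  forall (B X : {fset R}) (t : nat), {in X, forall x, t <= rep_diff A B x}%N ->
    (q * (t ^ 3 * #|` X|) <= H * #|` B| ^ 2)%N.

Lemma cube_moment_le (R : realFieldType) (A B X : {fset R}) (q H l : nat) :
  few_popular_diffs A q H -> (0 < l)%N -> (#|` A| < 2 ^ l)%N ->
  (q * \sum_(x <- X) rep_diff A B x ^ 3 <= 2 ^ 3 * l * (H * #|` B| ^ 2))%N.
Proof.
move=> few l_gt0 A_lt.
have [j j_lt] := @dyadic_pigeonhole _ X (fun=> 1%N) (rep_diff A B) 3 l l_gt0 isT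
  (fun x _ => leq_ltn_trans (rep_diff_le A B x) A_lt).
under eq_bigr do rewrite mul1n.
rewrite [in leqRHS]big_fset_condE -card_fset_sum1 /=.
set Xj := [fset x in X | _] => sum_le.
have Xj_few : (q * ((2 ^ j) ^ 3 * #|` Xj|) <= H * #|` B| ^ 2)%N.
  by apply: few => x; rewrite !inE => /and3P[].
apply: leq_trans (leq_mul (leqnn q) sum_le) _.
apply: leq_trans (leq_mul (leqnn _) Xj_few).
by rewrite expnM (expnS 2 j); apply/eq_leq; ring.
Qed.

(** On the dyadic class X_j that carries the sum, 4^j |X_j| is the geometric mean of
2^j |X_j| <= |A| |B| and of 8^j |X_j| <= (H / q) |B|^2; hence the bound on the
square of the moment. *)
Lemma square_moment_le (R : realFieldType) (A B X : {fset R}) (q H l : nat) :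
  few_popular_diffs A q H -> (0 < l)%N -> (#|` A| < 2 ^ l)%N ->
  (q * (\sum_(x <- X) rep_diff A B x ^ 2) ^ 2
     <= 2 ^ 4 * l ^ 2 * (H * #|` A| * #|` B| ^ 3))%N.
Proof.
move=> few l_gt0 A_lt.
have [j j_lt] := @dyadic_pigeonhole _ X (fun=> 1%N) (rep_diff A B) 2 l l_gt0 isT
  (fun x _ => leq_ltn_trans (rep_diff_le A B x) A_lt).
under eq_bigr do rewrite mul1n.
rewrite [in leqRHS]big_fset_condE -card_fset_sum1 /=.
set Xj := [fset x in X | _]; set E := (\sum_(x <- X) _)%N => sum_le.
have Xj_few : (q * ((2 ^ j) ^ 3 * #|` Xj|) <= H * #|` B| ^ 2)%N.
  by apply: few => x; rewrite !inE => /and3P[].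
have Xj_mass : (2 ^ j * #|` Xj| <= #|` A| * #|` B|)%N.
  apply: leq_trans (sum_rep_diff_le A B Xj).
  rewrite card_fset_sum1 big_distrr /= big_seq [leqRHS]big_seq.
  by apply: leq_sum => x; rewrite !inE muln1 => /and3P[].
apply: (@leq_trans (q * (l * (2 ^ (j.+1 * 2) * #|` Xj|)) ^ 2)).
  by rewrite leq_mul2l leq_sqr sum_le orbT.
apply: (@leq_trans (2 ^ 4 * l ^ 2 *
   (q * ((2 ^ j) ^ 3 * #|` Xj|) * (2 ^ j * #|` Xj|)))).
  by rewrite expnM (expnS 2 j); apply/eq_leq; ring.
rewrite leq_mul2l; apply/orP; right.
by apply: leq_trans (leq_mul Xj_few Xj_mass) _; apply/eq_leq; ring.
Qed.

Lemma sum_translate_le (R : realFieldType) (A X : {fset R}) (u v : R) :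
  (\sum_(x <- X) (((u + x)%R \in A) && ((v + x)%R \in A)) <= rep_diff A A (u - v))%N.
Proof.
rewrite /rep_diff sum_bool_count -size_filter.
rewrite sum_bool_count -[leqRHS]size_filter -(size_map (fun x => u + x)).
apply: uniq_leq_size.
  by rewrite map_inj_uniq ?filter_uniq ?fset_uniq //; apply: addrI.
move=> _ /mapP[x + ->]; rewrite !mem_filter => /andP[/andP[uA vA] _].
by rewrite uA (_ : _ - _ = v + x) ?vA //; ring.
Qed.

Lemma sum_sub_translate_le (R : realFieldType) (A X : {fset R}) (u v : R) :
  (\sum_(x <- X) (((u - x)%R \in A) && ((v - x)%R \in A)) <= rep_diff A A (u - v))%N.
Proof.
rewrite /rep_diff sum_bool_count -size_filter.
rewrite sum_bool_count -[leqRHS]size_filter -(size_map (fun x => u - x)).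
apply: uniq_leq_size.
  by rewrite map_inj_uniq ?filter_uniq ?fset_uniq // => x y /addrI/oppr_inj.
move=> _ /mapP[x + ->]; rewrite !mem_filter => /andP[/andP[uA vA] _].
by rewrite uA (_ : _ - _ = v - x) ?vA //; ring.
Qed.

(** Let D = A - A and M = |D|. For s in D put A_s = {c in A | c - s in A}, and let
f s d be the number of representations of d in A - A_s. If a is in A and c in A_s
then d = a - c and d + s = a - (c - s) are both in D (the inclusion of Katz and
Koester), so the |A| r(s) pairs are spread over the d in D with d + s in D. Take
the s with r(s) >= |A|^2 / (2M), which carry half of the pairs, and apply
Cauchy-Schwarz to the sum of f over these (s, d). The number of (s, d) is at most
2M / |A|^2 times the sum of r(s) times the number of such d, which is the energy
of A and D; the sum of f^2 counts pairs c, c' and is at most the third moment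
of r. *)
Lemma diff_energy_moments (R : realFieldType) (A : {fset R}) :
  (#|` A| ^ 8 <= 8 * #|` diff_set A A|
     * (\sum_(y <- diff_set A (diff_set A A)) rep_diff A (diff_set A A) y ^ 2)
     * \sum_(x <- diff_set A A) rep_diff A A x ^ 3)%N.
Proof.
set D := diff_set A A; set E2 := (\sum_(y <- _) _)%N; set E3 := (\sum_(x <- D) _)%N.
set n := #|` A|; set M := #|` D|.
have [->|n_gt0] := posnP n; first by rewrite exp0n.
pose P := [fset s in D | (n ^ 2 <= 2 * M * rep_diff A A s)%N].
pose f s d := (\sum_(c <- A) (((c - s)%R \in A) && ((c + d)%R \in A)))%N.
pose Z := (\sum_(p <- P `*` D) ((p.2 + p.1)%R \in D))%N.
(* differences with fewer than half of the average number of representations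
   account for at most half of all pairs *)
have popular : (n ^ 2 <= 2 * \sum_(s <- P) rep_diff A A s)%N.
  have total := sum_rep_diff_card A A.
  have M_gt0 : (0 < M)%N.
    rewrite lt0n; apply: contraTneq n_gt0 => /cardfs0_eq D0.
    move: total; rewrite -/D D0 big_seq_fset0 => /esym/eqP.
    by rewrite muln_eq0 orbb => /eqP n0; rewrite /n n0.
  pose U := [fset s in D | ~~ (n ^ 2 <= 2 * M * rep_diff A A s)%N].
  have unpopular : (2 * M * \sum_(s <- U) rep_diff A A s <= M * n ^ 2)%N.
    rewrite /U big_fset /= big_mkcond big_distrr /M card_fset_sum1 big_distrl /=.
    apply: leq_sum => s _; rewrite mul1n -card_fset_sum1.
    by case: ifP => [|_]; rewrite ?muln0 // -ltnNge => /ltnW.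
  move: total; rewrite (big_fsetID _ (fun s => n ^ 2 <= 2 * M * rep_diff A A s)%N) /=.
  rewrite -/D -/P -/U mulnn -/n => total.
  rewrite -(leq_pmul2l M_gt0); move: unpopular; rewrite -total mulnDr.
  move: (\sum_(s <- P) _)%N (\sum_(s <- U) _)%N => x y.
  by rewrite -mulnA (mulnCA M 2); move: (M * x)%N (M * y)%N => p q; clear; lia.
have fibre : (n * \sum_(s <- P) rep_diff A A s
    <= \sum_(p <- P `*` D) ((p.2 + p.1)%R \in D) * f p.1 p.2)%N.
  rewrite sum_fsetM big_distrr /=; apply: leq_sum => s _.
  under [leqRHS]eq_bigr do rewrite big_distrr.
  rewrite [leqRHS]exchange_big big_distrr /= big_seq [leqRHS]big_seq.
  apply: leq_sum => c cA; have [csA|_] := boolP (c - s \in A); last by rewrite muln0.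
  rewrite muln1 /=; under eq_bigr do rewrite mulnb.
  rewrite sum_bool_count -size_filter /n -(size_map (fun a => a - c)).
  apply: uniq_leq_size.
    by rewrite map_inj_uniq ?fset_uniq //; apply: addIr.
  move=> _ /mapP[a aA ->]; rewrite mem_filter mem_diff_set // andbT.
  have -> : a - c + s = a - (c - s) by ring.
  by rewrite mem_diff_set //= addrC subrK.
have Z_le : (n ^ 2 * Z <= 2 * M * E2)%N.
  pose rD s := (\sum_(d <- D) ((d + s)%R \in D))%N.
  have -> : Z = (\sum_(s <- P) rD s)%N by rewrite /Z sum_fsetM.
  apply: (@leq_trans (2 * M * \sum_(s <- D) rep_diff A A s * rD s)).
    rewrite big_fset /= big_mkcond !big_distrr /=; apply: leq_sum => s _.
    by case: ifP => [sP|_]; rewrite ?muln0 // mulnA leq_mul2r sP orbT.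
  rewrite leq_mul2l (sum_rep_diff A A rD); apply/orP; right.
  rewrite /E2; under [leqRHS]eq_bigr do rewrite -mulnn.
  rewrite (sum_rep_diff A D (rep_diff A D)) exchange_big; apply: leq_sum => a _.
  rewrite exchange_big /rep_diff /=; apply: leq_sum => d _.
  apply: leq_sum => a' _; rewrite (_ : d + _ = a' - (a - d)) //; ring.
(* for given c and c', both the choices of s and those of d are counted by the
   representations of c - c' *)
have f_sqr : (\sum_(p <- P `*` D) f p.1 p.2 ^ 2 <= E3)%N.
  have -> : E3 = (\sum_(c <- A) \sum_(c' <- A) rep_diff A A (c - c') ^ 2)%N.
    rewrite /E3 -(sum_rep_diff A A (fun x => rep_diff A A x ^ 2)%N).
    by apply: eq_bigr => x _; rewrite expnS.
  rewrite sum_fsetM /=.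
  pose g c c' s d := (((c - s)%R \in A) && ((c' - s)%R \in A)
     && (((c + d)%R \in A) && ((c' + d)%R \in A)) : nat).
  have -> : (\sum_(s <- P) \sum_(d <- D) f s d ^ 2
    = \sum_(c <- A) \sum_(c' <- A) \sum_(s <- P) \sum_(d <- D) g c c' s d)%N.
    under [RHS]eq_bigr do rewrite exchange_big.
    rewrite [RHS]exchange_big /=; apply: eq_bigr => s _.
    under [RHS]eq_bigr do rewrite exchange_big.
    rewrite [RHS]exchange_big /=; apply: eq_bigr => d _.
    rewrite -mulnn big_distrl /=; apply: eq_bigr => c _.
    rewrite big_distrr /=; apply: eq_bigr => c' _.
    by rewrite mulnb andbACA.
  apply: leq_sum => c _; apply: leq_sum => c' _.
  rewrite -mulnn; apply: leq_trans (leq_mul (sum_sub_translate_le A P c c')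
    (sum_translate_le A D c c')).
  rewrite big_distrl /=; apply: leq_sum => s _.
  by rewrite big_distrr /=; apply: leq_sum => d _; rewrite mulnb.
have := sum_nat_CauchySchwarz (P `*` D) (fun p => (p.2 + p.1)%R \in D : nat)
  (fun p => f p.1 p.2).
under [X in (_ <= X * _)%N]eq_bigr do rewrite -mulnn mulnb andbb.
rewrite -/Z => cauchy.
have key : (n ^ 6 <= 4 * (Z * E3))%N.
  apply: (@leq_trans ((2 * (n * \sum_(s <- P) rep_diff A A s)) ^ 2)).
    have -> : (n ^ 6 = (n * n ^ 2) ^ 2)%N by ring.
    by rewrite leq_sqr mulnCA leq_mul2l popular orbT.
  rewrite expnMn leq_mul2l /=.
  apply: leq_trans (leq_mul (leqnn Z) f_sqr).
  by apply: leq_trans cauchy; rewrite leq_sqr.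
have -> : (n ^ 8 = n ^ 2 * n ^ 6)%N by rewrite -expnD.
apply: leq_trans (leq_mul (leqnn _) key) _.
have -> : (n ^ 2 * (4 * (Z * E3)) = 4 * E3 * (n ^ 2 * Z))%N by ring.
apply: leq_trans (leq_mul (leqnn _) Z_le) _.
by apply/eq_leq; ring.
Qed.

(** Square diff_energy_moments and bound the energy of A and A - A by
square_moment_le and the third moment by cube_moment_le. *)
Lemma few_popular_diffs_growth (R : realFieldType) (A : {fset R}) (q H l : nat) :
  few_popular_diffs A q H -> (0 < l)%N -> (#|` A| < 2 ^ l)%N ->
  (q ^ 3 * #|` A| ^ 11 <= 2 ^ 16 * l ^ 4 * (H ^ 3 * #|` diff_set A A| ^ 5))%N.
Proof.
move=> few l_gt0 A_lt.
have [->|n_gt0] := posnP #|` A|; first by rewrite exp0n // muln0.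
have := diff_energy_moments A.
have := @square_moment_le _ A (diff_set A A) (diff_set A (diff_set A A)) _ _ _ few l_gt0 A_lt.
have := @cube_moment_le _ A A (diff_set A A) _ _ _ few l_gt0 A_lt.
move: (\sum_(x <- _) _)%N (\sum_(x <- _) _)%N #|` diff_set A A| => E2 E3 M.
move: #|` A| n_gt0 => n n_gt0 cubes squares moments.
rewrite -(leq_pmul2r (_ : 0 < n ^ 5)%N) ?expn_gt0 ?n_gt0 //.
have -> : (q ^ 3 * n ^ 11 * n ^ 5 = q ^ 3 * (n ^ 8) ^ 2)%N by ring.
apply: (@leq_trans (q ^ 3 * (8 * M * E2 * E3) ^ 2)).
  by rewrite leq_mul2l leq_sqr moments orbT.
have -> : (q ^ 3 * (8 * M * E2 * E3) ^ 2
  = 2 ^ 6 * M ^ 2 * ((q * E2 ^ 2) * (q * E3) ^ 2))%N by ring.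
apply: leq_trans (leq_mul (leqnn _) (leq_mul squares (_ : _ <= _ ^ 2)%N)) _.
  by rewrite leq_sqr; exact: cubes.
by apply/eq_leq; ring.
Qed.

(** * Multiplicative energy against differences *)

Lemma sum_ratio_hits_le (R : realFieldType) (A P : {fset R}) (a : R) :
  a != 0 -> (\sum_(p <- P) ((p * a)%R \in A) <= #|` A|)%N.
Proof.
move=> a0; apply: (sum_inj_leq (f := fun p => p * a)) => //; first exact: fset_uniq.
by move=> p p' _ _; apply: mulIf.
Qed.

(** Each x in X has t representations a - b, and each a has q ratios p in P with
p a in A; the point (p a, b) is then on the line of slope 1 / p and intercept - x.
So the |P| |X| lines have t q / |P| points of A x B on average, and rich_lines
applies when this is at least 8. Below 8, the trivial bound t |X| <= |A'| |B| is
enough, because q |A'| <= |A|^2. *)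
Lemma few_popular_diffs_ratio (R : realFieldType) (A A' P : {fset R}) (q : nat) :
  0 \notin A -> 0 \notin P -> A' `<=` A ->
  {in A', forall a, q <= \sum_(p <- P) ((p * a)%R \in A)}%N ->
  few_popular_diffs A' (q ^ 3) (2 ^ 8 * (#|` P| ^ 2 * #|` A| ^ 2)).
Proof.
move=> A0 P0 sA'A hits B X t popX.
have mass : (t * #|` X| <= #|` A'| * #|` B|)%N.
  apply: leq_trans (sum_rep_diff_le A' B X).
  rewrite card_fset_sum1 big_distrr /= big_seq [leqRHS]big_seq.
  by apply: leq_sum => x /popX; rewrite muln1.
have hits_mass : (q * #|` A'| <= \sum_(a <- A') \sum_(p <- P) ((p * a)%R \in A))%N.
  rewrite card_fset_sum1 big_distrr /= big_seq [leqRHS]big_seq.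
  by apply: leq_sum => a /hits; rewrite muln1.
have split3 : (q ^ 3 * (t ^ 3 * #|` X|) = (t * q) ^ 2 * (q * (t * #|` X|)))%N by ring.
have hits_le : (q * (t * #|` X|) <= q * #|` A'| * #|` B|)%N.
  by rewrite -mulnA leq_mul2l mass orbT.
have [P_eq0|P_gt0] := posnP #|` P|.
  rewrite split3 (_ : q * (t * #|` X|) = 0)%N ?muln0 //.
  apply/eqP; rewrite -leqn0; apply: leq_trans hits_le _.
  rewrite leqn0 muln_eq0 -leqn0; apply/orP; left; apply: leq_trans hits_mass _.
  by rewrite (cardfs0_eq P_eq0) big1 // => a _; rewrite big_seq_fset0.
have [few_hits|many_hits] := ltnP (t * q) (8 * #|` P|).
  have qA' : (q * #|` A'| <= #|` A| ^ 2)%N.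
    apply: leq_trans hits_mass _.
    apply: (@leq_trans (\sum_(a <- A') #|` A|)).
      rewrite big_seq [leqRHS]big_seq; apply: leq_sum => a aA'.
      apply: sum_ratio_hits_le; apply: contraNneq A0 => <-.
      exact: (fsubsetP sA'A).
    rewrite big_const_seq count_predT iter_addn addn0 -mulnn leq_mul2l.
    by rewrite fsubset_leq_card ?orbT.
  rewrite split3; apply: leq_trans (leq_mul (leqnn _) hits_le) _.
  apply: (@leq_trans ((8 * #|` P|) ^ 2 * (#|` A| ^ 2 * #|` B| ^ 2))).
    apply: leq_mul; first by rewrite leq_sqr ltnW.
    by apply: leq_mul => //; case: #|` B| => // b; rewrite -mulnn leq_pmulr.
  have -> : ((8 * #|` P|) ^ 2 * (#|` A| ^ 2 * #|` B| ^ 2)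
    = 2 ^ 6 * (#|` P| ^ 2 * #|` A| ^ 2 * #|` B| ^ 2))%N by ring.
  by rewrite -(mulnA (2 ^ 8)%N) leq_mul2r leq_exp2l ?orbT.
pose mkline (z : R * R) := (z.1^-1, - z.2).
have mkline_inj : injective mkline.
  by case=> p x [p' x'] [/invr_inj -> /oppr_inj ->].
pose L := [fset mkline z | z in P `*` X].
have cardL : #|` L| = (#|` P| * #|` X|)%N.
  by rewrite card_imfset //= -card_fsetM.
have p_neq0 p : p \in P -> p != 0 by move=> pP; apply: contraNneq P0 => <-.
have L0 : {in L, forall l, l.1 != 0}.
  move=> _ /imfsetP[[p x] /= + ->]; rewrite in_fsetM => /andP[/= pP _].
  by rewrite invr_eq0 p_neq0.
have := rich_lines (A := A) (B := B) L0 many_hits.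
rewrite cardL.
have -> : (t * q * (#|` P| * #|` X|) = #|` P| * (q * (t * #|` X|)))%N by ring.
have sumL : (q * (t * #|` X|) <= \sum_(l <- L) line_incidence A B l)%N.
  rewrite big_imfset /=; last by move=> z z' _ _; exact: mkline_inj.
  rewrite sum_fsetM exchange_big /=.
  rewrite [in leqLHS]card_fset_sum1 !big_distrr /= big_seq [leqRHS]big_seq.
  apply: leq_sum => x /popX; rewrite muln1 => popx.
  apply: leq_trans (leq_mul (leqnn q) popx) _.
  apply: (@leq_trans (\sum_(a <- A') \sum_(p <- P)
      (((p * a)%R \in A) && ((a - x)%R \in B)))).
    rewrite big_distrr /= big_seq [leqRHS]big_seq; apply: leq_sum => a /hits qa.
    case: (_ \in B); last by rewrite muln0.
    by under eq_bigr do rewrite andbT; rewrite muln1.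
  rewrite exchange_big /= big_seq [leqRHS]big_seq; apply: leq_sum => p /p_neq0 p0.
  rewrite /line_incidence !sum_bool_count -!size_filter -(size_map (fun a => p * a)).
  apply: uniq_leq_size.
    by rewrite map_inj_uniq ?filter_uniq ?fset_uniq //; apply: mulfI.
  move=> _ /mapP[a + ->]; rewrite !mem_filter => /andP[/andP[paA axB] _].
  by rewrite paA /line_at /= mulKf ?axB.
rewrite leq_mul2l sumL orbT => /(_ isT) rich.
rewrite -(leq_pmul2l P_gt0).
by apply: leq_trans (leq_trans (eq_leq _) rich) (eq_leq _); ring.
Qed.

(** With d = 2^j and q = 2^i: d^2 |P| is at least about E, d |P| is at most about
q |A'|, and both d |P| <= N^2 and q <= N hold. Growth of A' - A' gives
q^9 |A'|^11 <= |P|^6 N^6 M^5; multiplying by q^2 <= N^2, replacing q |A'| by d |P|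
and multiplying by d |P| <= N^2 turns the left side into (d |P|)^12, which is
E^6 |P|^6. *)
Lemma mult_energy_le_diff (R : realFieldType) (A : {fset R}) (l : nat) :
  0 \notin A -> (0 < l)%N -> (#|` A| < 2 ^ l)%N ->
  (mult_energy A ^ 6
     <= 2 ^ 63 * l ^ 21 * (#|` A| ^ 10 * #|` diff_set A A| ^ 5))%N.
Proof.
move=> A0 l_gt0 A_lt.
have A_neq0 a : a \in A -> a != 0 by move=> aA; apply: contraNneq A0 => <-.
have ratio_lt x : x \in ratio_set A -> (rep_ratio A x < 2 ^ l)%N.
  move=> _; apply: leq_ltn_trans A_lt; rewrite [leqRHS]card_fset_sum1.
  by apply: leq_sum => a _; case: (_ \in _).
have [j j_lt] := @dyadic_pigeonhole _ (ratio_set A) (fun=> 1%N) (rep_ratio A) 2 l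
  l_gt0 isT ratio_lt.
under eq_bigr do rewrite mul1n.
rewrite -/(mult_energy A) [in leqRHS]big_fset_condE -card_fset_sum1 /=.
set P := [fset x in ratio_set A | _] => energy_le.
have P0 : 0 \notin P.
  by apply: contraTN isT; rewrite !inE => /andP[/(ratio_set_neq0 A0)]; rewrite eqxx.
pose w a := (\sum_(p <- P) ((p * a)%R \in A))%N.
have w_le a : a \in A -> (w a <= #|` A|)%N.
  by move=> /A_neq0; apply: sum_ratio_hits_le.
have sum_w : (\sum_(a <- A) w a = \sum_(p <- P) rep_ratio A p)%N by rewrite exchange_big.
have w_ge : (2 ^ j * #|` P| <= \sum_(a <- A) w a)%N.
  rewrite sum_w card_fset_sum1 big_distrr /= big_seq [leqRHS]big_seq.
  by apply: leq_sum => p; rewrite !inE muln1 => /and3P[].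
have w_sum_le : (\sum_(a <- A) w a <= #|` A| ^ 2)%N.
  rewrite -mulnn [in leqRHS]card_fset_sum1 big_distrl /= big_seq [leqRHS]big_seq.
  by apply: leq_sum => a /w_le; rewrite mul1n -card_fset_sum1.
have [i i_lt] := @dyadic_pigeonhole _ A (fun=> 1%N) w 1 l l_gt0 isT
  (fun a aA => leq_ltn_trans (w_le a aA) A_lt).
under eq_bigr do rewrite mul1n expn1.
rewrite [in leqRHS]big_fset_condE -card_fset_sum1 /= muln1.
set A' := [fset a in A | _] => mass_le.
have sA'A : A' `<=` A by apply/fsubsetP => a; rewrite inE => /andP[].
have hits : {in A', forall a, 2 ^ i <= w a}%N by move=> a; rewrite !inE => /and3P[].
have few := few_popular_diffs_ratio A0 P0 sA'A hits.
have A'_le : (#|` A'| <= #|` A|)%N by exact: fsubset_leq_card.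
have := few_popular_diffs_growth few l_gt0 (leq_ltn_trans A'_le A_lt).
have D_le : (#|` diff_set A' A'| <= #|` diff_set A A|)%N.
  apply: fsubset_leq_card; apply/fsubsetP => _ /imfsetP[[a b] /= + ->].
  by rewrite in_fsetM => /andP[/(fsubsetP sA'A) aA /(fsubsetP sA'A) bA]; apply: mem_diff_set.
have q_le : (0 < #|` A'| -> 2 ^ i <= #|` A|)%N.
  rewrite cardfs_gt0 => /fset0Pn[a aA'].
  by apply: leq_trans (hits _ aA') (w_le _ _); exact: (fsubsetP sA'A).
move: energy_le mass_le w_ge; rewrite expnM (expnS 2 j) (expnS 2 i).
move: q_le A'_le D_le w_sum_le; move: #|` diff_set A A| #|` diff_set A' A'| => M M'.
move: #|` P| #|` A'| #|` A| (mult_energy A) (2 ^ j)%N (2 ^ i)%N (\sum_(a <- A) w a)%N.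
clear => p n N E d q W q_le nN M'M W_le E_le W_mass W_ge growth.
have growthM : (q ^ 9 * n ^ 11 <= 2 ^ 40 * l ^ 4 * (p ^ 6 * N ^ 6 * M ^ 5))%N.
  apply: leq_trans (leq_trans (eq_leq _) growth) _; first by ring.
  apply: (@leq_trans (2 ^ 16 * l ^ 4 * ((2 ^ 8 * (p ^ 2 * N ^ 2)) ^ 3 * M ^ 5))).
    by rewrite !leq_mul2l leq_exp2r // M'M !orbT.
  by apply/eq_leq; ring.
have [p0|p_gt0] := posnP p.
  by move: E_le; rewrite p0 !muln0 leqn0 => /eqP ->; rewrite exp0n.
have dp_le : (d * p <= 2 * l * (q * n))%N.
  by apply: leq_trans W_ge (leq_trans W_mass (eq_leq _)); ring.
have dp_pow : ((d * p) ^ 11 <= 2 ^ 51 * l ^ 15 * (p ^ 6 * N ^ 8 * M ^ 5))%N.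
  apply: (@leq_trans ((2 * l * (q * n)) ^ 11)); first by rewrite leq_exp2r.
  have [n0|n_gt0] := posnP n; first by rewrite n0 !muln0 exp0n.
  have -> : ((2 * l * (q * n)) ^ 11 = 2 ^ 11 * l ^ 11 * (q ^ 2 * (q ^ 9 * n ^ 11)))%N.
    by ring.
  apply: (@leq_trans (2 ^ 11 * l ^ 11 * (N ^ 2 *
      (2 ^ 40 * l ^ 4 * (p ^ 6 * N ^ 6 * M ^ 5))))).
    by rewrite leq_mul2l leq_mul ?orbT // leq_sqr q_le.
  by apply/eq_leq; ring.
rewrite -(leq_pmul2r (_ : 0 < p ^ 6)%N) ?expn_gt0 ?p_gt0 //.
apply: (@leq_trans (2 ^ 12 * l ^ 6 * ((d * p) * (d * p) ^ 11))).
  apply: (@leq_trans ((l * ((2 * d) ^ 2 * p)) ^ 6 * p ^ 6)).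
    by rewrite leq_mul2r leq_exp2r // E_le orbT.
  by apply/eq_leq; ring.
apply: (@leq_trans (2 ^ 12 * l ^ 6 * (N ^ 2 *
    (2 ^ 51 * l ^ 15 * (p ^ 6 * N ^ 8 * M ^ 5))))).
  by rewrite leq_mul2l leq_mul ?orbT // (leq_trans W_ge).
by apply/eq_leq; ring.
Qed.

(** * The trade-off *)

(** Eliminating E between the sixth power of energy_prod_diff and
mult_energy_le_diff leaves N^36 <= S^12 N^10 S^5 up to logarithms. *)
Lemma prod_diff_growth (R : realFieldType) (A S : {fset R}) (l : nat) :
  0 \notin A -> (0 < l)%N -> (#|` A| < 2 ^ l)%N ->
  (forall a b c, a \in A -> b \in A -> c \in A -> a * (b - c) \in S) ->
  (#|` A| ^ 26 <= 2 ^ 135 * l ^ 33 * #|` S| ^ 17)%N.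
Proof.
move=> A0 l_gt0 A_lt AS.
have [->|A_gt0] := posnP #|` A|; first by rewrite exp0n.
have D_le : (#|` diff_set A A| <= #|` S|)%N.
  move: (A_gt0); rewrite cardfs_gt0 => /fset0Pn[a aA].
  have a0 : a != 0 by apply: contraNneq A0 => <-.
  rewrite -(size_map (fun x => a * x)); apply: uniq_leq_size.
    by rewrite map_inj_uniq ?fset_uniq //; apply: mulfI.
  move=> _ /mapP[x /imfsetP[[b c] /= + ->] ->].
  by rewrite in_fsetM => /andP[bA cA]; apply: AS.
have := energy_prod_diff A0 l_gt0 A_lt AS.
have := mult_energy_le_diff A0 l_gt0 A_lt.
move: D_le; move: #|` diff_set A A| #|` S| (mult_energy A) => M s E Ms.
move: #|` A| A_gt0 => N N_gt0 E_le E_ge.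
rewrite -(leq_pmul2r (_ : 0 < N ^ 10)%N) ?expn_gt0 ?N_gt0 // -expnD.
apply: (@leq_trans ((2 ^ 12 * l ^ 2 * s ^ 2 * E) ^ 6)).
  by rewrite (expnM N 6 6) leq_exp2r.
apply: (@leq_trans (2 ^ 72 * l ^ 12 * s ^ 12 *
    (2 ^ 63 * l ^ 21 * (N ^ 10 * s ^ 5)))); last by apply/eq_leq; ring.
apply: (@leq_trans (2 ^ 72 * l ^ 12 * s ^ 12 * E ^ 6)); first by apply/eq_leq; ring.
rewrite leq_mul2l (leq_trans E_le) ?orbT //.
by rewrite !leq_mul2l leq_exp2r // Ms !orbT.
Qed.

(** Since A has at least two elements, removing 0 at most halves its cardinal. *)
Lemma prod_diff_growth_with_zero (R : realFieldType) (A S : {fset R}) (l : nat) :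
  (1 < #|` A|)%N -> (0 < l)%N -> (#|` A| < 2 ^ l)%N ->
  (forall a b c, a \in A -> b \in A -> c \in A -> a * (b - c) \in S) ->
  (#|` A| ^ 26 <= 2 ^ 161 * l ^ 33 * #|` S| ^ 17)%N.
Proof.
move=> A_gt1 l_gt0 A_lt AS; pose A1 := A `\ 0.
have A1_0 : 0 \notin A1 by rewrite !inE eqxx.
have sA1A : {subset A1 <= A} by move=> a; rewrite !inE => /andP[].
have A_le : (#|` A| <= 2 * #|` A1|)%N.
  move: A_gt1; rewrite (cardfsD1 0 A) -/A1.
  by case: (0 \in A); move: #|` A1| => n; lia.
apply: (@leq_trans ((2 * #|` A1|) ^ 26)); first by rewrite leq_exp2r.
apply: (@leq_trans (2 ^ 26 * (2 ^ 135 * l ^ 33 * #|` S| ^ 17))); last first.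
  by apply/eq_leq; ring.
rewrite expnMn leq_mul2l prod_diff_growth ?orbT //.
  by apply: leq_ltn_trans A_lt; apply: fsubset_leq_card; apply: fsubD1set.
by move=> a b c /sA1A aA /sA1A bA /sA1A cA; apply: AS.
Qed.

Lemma card_le_prod_diff (R : realFieldType) (A S : {fset R}) :
  (1 < #|` A|)%N ->
  (forall a b c, a \in A -> b \in A -> c \in A -> a * (b - c) \in S) ->
  (#|` A| <= #|` S|)%N.
Proof.
move=> A_gt1 AS.
have : (0 < #|` A `\ 0%R|)%N.
  by move: A_gt1; rewrite (cardfsD1 0 A); case: (0 \in A); case: #|` _ `\ _|.
rewrite cardfs_gt0 => /fset0Pn[a]; rewrite !inE => /andP[a0 aA].
rewrite -(size_map (fun x => a * (x - a))); apply: uniq_leq_size.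
  by rewrite map_inj_uniq ?fset_uniq // => x y /(mulfI a0)/addIr.
by move=> _ /mapP[x xA ->]; apply: AS.
Qed.

Theorem theorem1p2 (R : realType) :
  exists c C : R, [/\ 0 < c, 0 < C &
    forall A : {fset R}, (2 <= #|` A|)%N ->
      C * ((#|` A|%:R : R) `^ (3 / 2 + 1 / 34)
           / (log2 (#|` prod_diff_set A|%:R : R)) `^ c)
        <= (#|` prod_diff_set A|%:R : R) ].
Proof.
exists (33 / 17), (2 ^- 12); split => [||A A_ge2]; first by lra.
  by rewrite invr_gt0 exprn_gt0.
set S := prod_diff_set A; set N := #|` A|; set L := log2 _.
have AS a b c : a \in A -> b \in A -> c \in A -> a * (b - c) \in S.
  move=> aA bA cA; apply/imfsetP; exists (a, (b, c)) => //=.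
  by rewrite !in_fsetM /= aA bA.
have NS : (N <= #|` S|)%N by exact: card_le_prod_diff.
pose l := (trunc_log 2 N).+1.
have /andP[N_ge N_lt] : (2 ^ l.-1 <= N < 2 ^ l)%N by apply: trunc_log_bounds; lia.
have ln2_gt0 : 0 < ln 2 :> R by rewrite ln_gt0 // ltr1n.
have L_ge k : (2 ^ k <= #|` S|)%N -> k%:R <= L.
  move=> kS; rewrite /L /log2 ler_pdivlMr // mulr_natl -lnXn //.
  have S_gt0 : (0 < #|` S|)%N by apply: leq_trans kS; rewrite expn_gt0.
  by rewrite ler_ln ?posrE ?exprn_gt0 ?ltr0n // -natrX ler_nat.
have L_ge1 : 1 <= L by apply: (L_ge 1%N); lia.
(* N lies in [2^(l-1), 2^l), so l - 1 <= L, and 1 <= L *)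
have l_le : l%:R <= 2 * L.
  have := L_ge _ (leq_trans N_ge NS); rewrite /l -natr1 /=; lra.
have L_gt0 : 0 < L by apply: lt_le_trans L_ge1.
have root17 (x : R) (n : nat) : 0 <= x -> (x `^ (n%:R / 17)) ^+ 17 = x ^+ n.
  by move=> x0; rewrite -powR_mulrn ?powR_ge0 // -powRrM divfK ?pnatr_eq0 // powR_mulrn.
have -> : 3 / 2 + 1 / 34 = 26 / 17 :> R by field.
(* compare 17th powers, which makes all exponents integral *)
rewrite -(@ler_pXn2r _ 17) ?nnegrE ?mulr_ge0 ?invr_ge0 ?powR_ge0 ?exprn_ge0 //.
rewrite !exprMn !exprVn (root17 _ 26%N) ?(root17 _ 33%N) ?ler0n ?(ltW L_gt0) //.
rewrite mulrA ler_pdivrMr ?exprn_gt0 // mulrC ler_pdivrMr ?exprn_gt0 ?ltr0n //.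
have := prod_diff_growth_with_zero A_ge2 (ltn0Sn _ : 0 < l)%N N_lt AS.
rewrite -(ler_nat R) (natrM _ _ (#|` S| ^ 17)%N).
rewrite (natrM _ (2 ^ 161)%N (l ^ 33)%N) !natrX => growth.
apply: le_trans growth _.
apply: (@le_trans _ _ (2 ^+ 161 * (2 * L) ^+ 33 * #|` S|%:R ^+ 17)).
  rewrite ler_wpM2r ?exprn_ge0 // ler_wpM2l ?exprn_ge0 //.
  by rewrite lerXn2r ?nnegrE ?ler0n // mulr_ge0 // ltW.
(* 161 + 33 <= 12 * 17, which is where the constant 2^-12 comes from *)
rewrite [leRHS](_ : _ = 2 ^+ 161 * (2 * L) ^+ 33 * #|` S|%:R ^+ 17 * 2 ^+ 10); last by ring.
apply: ler_peMr; last by rewrite exprn_ege1 // ler1n.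
by rewrite mulr_ge0 ?exprn_ge0 // mulr_ge0 ?exprn_ge0 // mulr_ge0 // ltW.
Qed.
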